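(* Let $G$ be a finite undirected graph (possibly with loops and multiple edges) with nonempty vertex set $V$ and edge set $E$, and let $b\in\mathbb{R}^V$ have all entries nonnegative. Let $F$ be a nonempty face of $\mathcal{P}(G,b)$. Then: (i) $F$ is affinely isomorphic to $\mathcal{P}(\mathrm{gr}(F),b)$. (ii) The dimension of $F$ is $|\mathrm{supp}(F)|-|V|+B$, where $B$ is the number of bipartite components of $\mathrm{gr}(F)$.
   Context: $\delta_G(v)$ denotes the set of edges of $G$ incident with $v$; a loop at $v$ appears once in $\delta_G(v)$. $\mathcal{P}(G,b)=\{x\in\mathbb{R}^E \mid x_e\ge 0 \text{ for each } e\in E,\ \sum_{e\in\delta_G(v)}x_e=b_v \text{ for each } v\in V\}$ (a polytope; when $E=\emptyset$, $\mathbb{R}^\emptyset=\{0\}$, so it is $\{0\}$ if $b=0$ and $\emptyset$ otherwise). The polytope itself counts as one of its faces. For $X\subset\mathcal{P}(G,b)$, $\mathrm{supp}(X)=\{e\in E\mid \text{there exists } x\in X \text{ with } x_e\neq 0\}$, and $\mathrm{gr}(X)$ is the spanning subgraph of $G$ (vertex set $V$) with edge set $\mathrm{supp}(X)$. A graph with loops is bipartite if and only if it has no odd-length cycle, where a vertex with a loop is a cycle of length 1 and two distinct parallel edges between two distinct vertices form a cycle of length 2; in particular an isolated vertex (with no loop) is a bipartite component. *)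

(* Defs.v *)
From HB Require Import structures.
From mathcomp Require Import all_boot all_order all_algebra.
From mathcomp Require Import boolp classical_sets functions reals.

Set Implicit Arguments.
Unset Strict Implicit.
Unset Printing Implicit Defensive.

Import Order.TTheory GRing.Theory Num.Theory.
Local Open Scope classical_set_scope.
Local Open Scope ring_scope.

Section Affine.
Variables (R : realType) (U W : vectType R).

Definition affine_hull (X : set U) : set U :=
  [set y | exists (n : nat) (p : 'I_n -> U) (a : 'I_n -> R),
     [/\ forall i, X (p i), \sum_i a i = 1 & y = \sum_i a i *: p i]].

(* The integer d is the dimension of the affine hull of X; no d satisfies this
   for X empty. *)
Definition has_dimension (X : set U) (d : int) : Prop :=
  exists (x0 : U) (D : {vspace U}),
    affine_hull X = [set x0 + u | u in [set` D]] /\ (\dim D)%:Z = d.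

Lemma has_dimension_unique (X : set U) (d d' : int) :
  has_dimension X d -> has_dimension X d' -> d = d'.
Proof.
have sub x0 (D : {vspace U}) x1 (D' : {vspace U}) :
    affine_hull X = [set x0 + u | u in [set` D]] ->
    affine_hull X = [set x1 + u | u in [set` D']] -> (D <= D')%VS.
  move=> -> eqX; apply/subvP => u uD.
  have sub1 v : v \in D -> exists2 w, w \in D' & x1 + w = x0 + v.
    move=> vD; have [w wD' <-] : [set x1 + w | w in [set` D']] (x0 + v).
      by rewrite -eqX; exists v.
    by exists w.
  have [w wD' ew] := sub1 _ uD; have [z zD' ez] := sub1 _ (mem0v D).
  have -> : u = w - z; last by rewrite memvB.
  apply: (addrI x0); rewrite -ew -[in RHS](addr0 x0) -(addrA x0) add0r.
  by rewrite -[x0 in RHS]addr0 -ez -addrA; congr (_ + _); rewrite addrC subrK.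
move=> [x0 [D [eD <-]]] [x1 [D' [eD' <-]]].
by congr (Posz (\dim _)); apply/eqP;
  rewrite eqEsubv !(sub _ _ _ _ eD eD', sub _ _ _ _ eD' eD).
Qed.

(* The set X itself is the face given by c = 0 and d = 0. *)
Definition is_face (X F : set U) : Prop :=
  exists (c : 'Hom(U, R^o)) (d : R),
    (forall x, X x -> (c x : R) <= d) /\ F = X `&` [set x | c x = d].

Definition affinely_isomorphic (X : set U) (Y : set W) : Prop :=
  exists (g : 'Hom(U, W)) (w : W), set_bij X Y (fun x => g x + w).

End Affine.

(* Graph with vertex set V and edge set E: an edge is a loop when it has a
   single end, and distinct edges may have the same ends. *)
Record multigraph (V E : finType) := Multigraph {
  ends : E -> {set V};
  card_ends : forall e, (0 < #|ends e| <= 2)%N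
}.

Section Graphs.
Variables (V E : finType) (G : multigraph V E).

Definition delta (v : V) : {set E} := [set e | v \in ends G e]%SET.

Definition adj : rel V := fun u v => [exists e, ends G e == [set u; v]%SET].

Definition components : {set {set V}} :=
  equivalence_partition (connect adj) [set: V]%SET.

(* The pairs (v_0, e_0), ..., (v_(k-1), e_(k-1)) list the vertices and edges of
   a cycle of length k, where e_i joins v_i to v_(i+1), indices mod k. A loop
   gives k = 1 and a pair of parallel edges gives k = 2. *)
Definition graph_cycle (c : seq (V * E)) : Prop :=
  [/\ c != [::], uniq (unzip1 c), uniq (unzip2 c) &
      cycle (fun p q => ends G p.2 == [set p.1; q.1]%SET) c].

(* C induces a bipartite subgraph. *)
Definition bipartite_on (C : {set V}) : Prop :=
  forall c, graph_cycle c -> {subset unzip1 c <= C} -> ~~ odd (size c).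

Definition bipartite_components : {set {set V}} :=
  [set C in components | `[< bipartite_on C >]]%SET.

Definition subgraph (A : {set E}) : multigraph V {e : E | e \in A} :=
  Multigraph (fun e => card_ends G (val e)).

End Graphs.

Section Polytope.
Variables (R : realType) (V E : finType) (G : multigraph V E).

(* R^o is R as a vector space over itself. *)
Definition bpolytope (b : {ffun V -> R}) : set {ffun E -> R^o} :=
  [set x | (forall e, 0 <= (x e : R)) /\
           (forall v, \sum_(e in delta G v) x e = b v)].

Definition supp (X : set {ffun E -> R^o}) : {set E} :=
  [set e | `[< exists2 x, X x & x e != 0 >]]%SET.

Definition gr (X : set {ffun E -> R^o}) :
    multigraph V {e : E | e \in supp X} := subgraph G (supp X).

End Polytope.

(* Main.v *)
(* A maximal-support point x of the face F is positive on supp(F), so every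
   vector u supported on supp(F) with zero sum at each vertex gives a segment
   x + t u, |t| small, inside the polytope.  Hence F consists of all points of
   the polytope supported on supp(F), which is (i), and its affine hull is
   x + ker M for the incidence matrix M of gr(F).  By orthogonality
   dim ker M - |supp(F)| = dim ker M^T - |V|, and ker M^T consists of the vertex
   weightings that change sign along every edge: they vanish on each
   non-bipartite component and are determined by one value on each bipartite
   one. *)
Require Import Defs.
From HB Require Import structures.
From mathcomp Require Import all_boot all_order all_algebra.
From mathcomp Require Import boolp classical_sets functions reals.

Set Implicit Arguments.
Unset Strict Implicit.
Unset Printing Implicit Defensive.

Import Order.TTheory GRing.Theory Num.Theory.
Local Open Scope classical_set_scope.
Local Open Scope ring_scope.

(** * Odd closed walks and the bipartite double cover *)

Lemma not_uniq_mapP (T T' : eqType) (f : T -> T') (s : seq T) :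
  ~~ uniq (map f s) ->
  exists a x b y d, s = a ++ x :: b ++ y :: d /\ f x = f y.
Proof.
elim: s => [|x s IHs] //=; rewrite negb_and negbK => /orP[/mapP[y ys fxy]|].
  case/splitPr: ys => b d.
  by exists [::], x, b, y, d.
by move=> /IHs[a [x' [b [y [d [-> fxy]]]]]]; exists (x :: a), x', b, y, d.
Qed.

Section OddClosedWalks.
Variables (V E : finType) (G : multigraph V E).

Lemma ends_set2 (e : E) : exists u v, ends G e = [set u; v]%SET.
Proof.
have := card_ends G e; case eq_k: #|ends G e| => [|[|[|k]]] // _.
  by have /eqP/cards1P[v ->] := eq_k; exists v, v; rewrite finset.setUid.
by have /eqP/cards2P[u [v [_ ->]]] := eq_k; exists u, v.
Qed.

(** The step relation of [graph_cycle]: [cycle joins] describes closed walks, with repetitions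
    allowed. *)
Definition joins (p q : V * E) : bool := ends G p.2 == [set p.1; q.1]%SET.

Lemma adj_sym : symmetric (adj G).
Proof. by move=> u v; rewrite /adj finset.setUC. Qed.

Lemma joins_adj p q : joins p q -> adj G p.1 q.1.
Proof. by move=> pq; apply/existsP; exists p.2. Qed.

(** Serves to cut a closed walk at two chosen entries into the pieces [x :: b] and [y :: d ++ a]. *)
Lemma repeat_rot (c a b d : seq (V * E)) x y :
    c = a ++ x :: b ++ y :: d ->
  [/\ cycle joins c = cycle joins (x :: b ++ y :: d ++ a),
      perm_eq c (x :: b ++ y :: d ++ a) &
      size c = (size b + size (d ++ a)).+2].
Proof.
move=> ->; have -> : x :: b ++ y :: d ++ a = rot (size a) (a ++ x :: b ++ y :: d).
  by rewrite rot_size_cat /= -!catA.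
rewrite rot_cycle perm_sym perm_rot; split=> //.
by rewrite !size_cat /= !size_cat /= !addnS addnCA (addnC (size a)).
Qed.

(** If [x] and [y] use the same edge from distinct vertices, each is followed by the vertex of the
    other. Distinctness of the vertices then leaves only [x] and [y], a walk of even length 2. *)
Lemma cycle_uniq_edges (c : seq (V * E)) :
  cycle joins c -> uniq (unzip1 c) -> odd (size c) -> uniq (unzip2 c).
Proof.
move=> cyc uc; apply: contraTT => /not_uniq_mapP[a [x [b [y [d [ec exy]]]]]].
have [rot_c /(perm_map fst)/perm_uniq per_c ->] := repeat_rot ec.
move: cyc uc; rewrite rot_c [uniq _]per_c; move: (d ++ a) => {rot_c per_c ec}a.
move=> cyc uc.
have /andP[/eqP jx /eqP jy] : joins x (head y b) && joins y (head x a).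
  move: cyc; rewrite /= rcons_cat cat_path /= => /and3P[pb jb pa].
  apply/andP; split; first by case: (b) pb jb => [|z b'] //= /andP[].
  by case: (a) pa => [|w a'] /= /andP[].
have xy : x.1 != y.1.
  move: uc => /= /andP[+ _]; apply: contraNneq => ->.
  by rewrite map_cat mem_cat mem_head orbT.
have := set21 x.1 (head y b).1; rewrite -jx exy jy => /set2P[/eqP|xa].
  by rewrite (negPf xy).
have := set21 y.1 (head x a).1; rewrite -jy -exy jx => /set2P[/eqP|yb].
  by rewrite eq_sym (negPf xy).
case: a xa uc {cyc jx jy} => [_|w a /= -> /andP[]]; last first.
  by rewrite map_cat mem_cat /= !inE eqxx !orbT.
case: b yb => [_ //|z b /= yz /and3P[_]].
by rewrite map_cat mem_cat /= yz mem_head orbT.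
Qed.

(** Induction on the length: a repeated vertex splits the walk into two shorter closed walks, one of
    them odd; without repetition the walk is a cycle by [cycle_uniq_edges]. *)
Lemma odd_closed_walk_cycle (c : seq (V * E)) :
  cycle joins c -> odd (size c) ->
  exists c', [/\ graph_cycle G c', odd (size c') &
                 {subset unzip1 c' <= unzip1 c}].
Proof.
have [n] := ubnP (size c); elim: n c => // n IHn c ltcn cyc oddc.
have [uc|/not_uniq_mapP[a [x [b [y [d [ec exy]]]]]]] := boolP (uniq (unzip1 c)).
  exists c; split=> //; split=> //; last exact: cycle_uniq_edges.
  by case: (c) oddc.
have [rot_c /(perm_map fst)/perm_mem mem_c sz_c] := repeat_rot ec.
move: cyc; rewrite rot_c; move: oddc; rewrite sz_c /= negbK.
move: ltcn; rewrite sz_c ltnS => ltn.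
move: mem_c; move: (d ++ a) ltn => {ec rot_c sz_c}a ltn mem_c oddab.
rewrite rcons_cat cat_path /= => /and3P[pb jb pa].
have joinsE z : joins z x = joins z y by rewrite /joins exy.
have cyb : cycle joins (x :: b) by rewrite /= rcons_path pb joinsE.
have cya : cycle joins (y :: a).
  by move: pa; rewrite /= !rcons_path joinsE.
have [odda|evena] := boolP (odd (size (y :: a))).
  have [|c' [gc oc sc]] := IHn _ _ cya odda.
    by rewrite (leq_trans _ ltn)//= !ltnS leq_addl.
  exists c'; split=> // z /sc /= zy; rewrite mem_c /= inE map_cat mem_cat /=.
  by move: zy; rewrite !inE => ->; rewrite !orbT.
have [||c' [gc oc sc]] := IHn _ _ cyb.
- by rewrite (leq_trans _ ltn)//= !ltnS leq_addr.
- by move: oddab evena; rewrite /= oddD; case: odd; case: odd.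
exists c'; split=> // z /sc /=; rewrite mem_c /= !inE map_cat mem_cat.
by case/orP=> ->; rewrite ?orbT.
Qed.

(** The final entry [z] stays free apart from its vertex, so that a closed walk can end in its own
    first entry. *)
Lemma adj_path_walk (u w : V) (p : seq V) :
  path (adj G) u (rcons p w) ->
  exists (e : E) (c : seq (V * E)), unzip1 c = p /\
    forall z, z.1 = w -> path joins (u, e) (rcons c z).
Proof.
elim: p u => [|v p IHp] u /=.
  rewrite andbT => /existsP[e ue]; exists e, [::]; split=> // z zw.
  by rewrite /= andbT /joins zw.
case/andP=> /existsP[e ue] /IHp[e' [c [<- jc]]].
exists e, ((v, e') :: c); split=> //= z zw.
by rewrite {1}/joins /= ue jc.
Qed.

(** Adjacency in the bipartite double cover: the boolean records the parity of the walk. *)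
Definition double_adj : rel (V * bool) :=
  fun p q => adj G p.1 q.1 && (q.2 == ~~ p.2).

Lemma double_adj_sym : symmetric double_adj.
Proof.
by move=> [u a] [v b]; rewrite /double_adj /= adj_sym; case: a; case: b.
Qed.

Lemma double_adj_path p s : path double_adj p s ->
  path (adj G) p.1 (unzip1 s) /\ (last p s).2 = p.2 (+) odd (size s).
Proof.
elim: s p => [|q s IHs] p /=; first by rewrite addbF.
case/andP=> /andP[pq /eqP eq2] /IHs[-> ->]; rewrite pq eq2.
by split=> //; rewrite addNb addbN.
Qed.

Lemma connect_double_adj p q :
  connect double_adj p q -> connect (adj G) p.1 q.1.
Proof.
case/connectP=> s /double_adj_path[ps _] ->; apply/connectP.
by exists (unzip1 s) => //; rewrite last_map.
Qed.

(** A path between the two copies of [r] projects to a closed walk of odd length at [r]. *)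
Lemma double_connect_cycle r :
  connect double_adj (r, false) (r, true) ->
  exists c, [/\ graph_cycle G c, odd (size c) &
                {subset unzip1 c <= connect (adj G) r}].
Proof.
case/connectP=> s /double_adj_path[]; case/lastP: s => // s q.
rewrite /unzip1 map_rcons last_rcons => ps + eq.
rewrite -eq /= size_rcons => /esym odd_s.
move: (ps); rewrite -eq /= => /adj_path_walk[e [c [cs walk]]].
have [||c' [gc oc sc]] := @odd_closed_walk_cycle ((r, e) :: c).
- exact: walk.
- by move: (congr1 size cs); rewrite !size_map => /= ->.
exists c'; split=> // v /sc; rewrite /= cs => vs.
apply: (path_connect ps); move: vs; rewrite !inE mem_rcons inE.
by case/orP=> ->; rewrite ?orbT.
Qed.

End OddClosedWalks.

(** * Kernels of incidence matrices *)

Lemma dim_ffun (R : fieldType) (I : finType) :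
  \dim (fullv : {vspace {ffun I -> R^o}}) = #|I|.
Proof. by rewrite dimvf /dim /= muln1. Qed.

Section FunctionMatrix.
Variables (R : realFieldType) (I J : finType) (a : I -> J -> R).

Definition matfun (x : {ffun J -> R^o}) : {ffun I -> R^o} :=
  [ffun i => \sum_j a i j * x j].

Fact matfun_is_linear : linear matfun.
Proof.
move=> k x y; apply/ffunP => i; rewrite !ffunE scaler_sumr -big_split /=.
by apply: eq_bigr => j _; rewrite !ffunE mulrDr /GRing.scale /= mulrCA.
Qed.

HB.instance Definition _ :=
  GRing.isLinear.Build R {ffun J -> R^o} {ffun I -> R^o} _ matfun
    matfun_is_linear.

Definition matlin : 'Hom({ffun J -> R^o}, {ffun I -> R^o}) := linfun matfun.

Lemma matlinE x i : matlin x i = \sum_j a i j * x j.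
Proof. by rewrite lfunE /= ffunE. Qed.

Lemma matlin_kerP (x : {ffun J -> R^o}) :
  reflect (forall i, \sum_j a i j * x j = 0) (x \in lker matlin).
Proof.
rewrite memv_ker; apply: (iffP eqP) => [x0 i|x0].
  by rewrite -matlinE x0 ffunE.
by apply/ffunP => i; rewrite matlinE x0 ffunE.
Qed.

End FunctionMatrix.

(* Over an ordered field the image of the transpose meets the kernel only in 0,
   because [<a^T y, a^T y> = <y, a a^T y>]. *)
Lemma dim_lker_transpose_le (R : realFieldType) (I J : finType)
    (a : I -> J -> R) :
  (\dim (lker (matlin a)) + #|I| <=
   #|J| + \dim (lker (matlin (fun j i => a i j))))%N.
Proof.
set f := matlin a; set g := matlin _.
have disj : (limg g :&: lker f = 0)%VS.
  apply/eqP; rewrite -subv0; apply/subvP => x.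
  rewrite memv_cap memv0 => /andP[/memv_imgP[y _ xy] /matlin_kerP fx].
  have : \sum_j (x j : R) ^+ 2 = 0.
    transitivity (\sum_i (y i : R) * \sum_j a i j * x j); last first.
      by rewrite big1 // => i _; rewrite fx mulr0.
    under [RHS]eq_bigr do rewrite mulr_sumr.
    rewrite exchange_big /=; apply: eq_bigr => j _.
    rewrite expr2 {1}xy matlinE mulr_suml; apply: eq_bigr => i _.
    by rewrite mulrA [y i * _]mulrC.
  move=> /eqP; rewrite psumr_eq0 => [/allP x0|j _]; last exact: sqr_ge0.
  apply/eqP/ffunP => j; apply/eqP.
  by have := x0 j (mem_index_enum _); rewrite sqrf_eq0 ffunE.
have := dimvS (subvf (limg g + lker f)).
rewrite (dimv_disjoint_sum disj) dim_ffun => le_J.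
have := limg_ker_dim g fullv; rewrite capfv dim_ffun => <-.
by rewrite addnCA addnC leq_add2r addnC.
Qed.

Lemma dim_lker_transpose (R : realFieldType) (I J : finType)
    (a : I -> J -> R) :
  (\dim (lker (matlin a)) + #|I| =
   #|J| + \dim (lker (matlin (fun j i => a i j))))%N.
Proof.
apply/eqP; rewrite eqn_leq dim_lker_transpose_le /= addnC.
by rewrite (leq_trans (dim_lker_transpose_le (fun j i => a i j))) // addnC.
Qed.

(** * The incidence matrix and the kernel of its transpose *)

Section Incidence.
Variables (R : realFieldType) (V E : finType) (G : multigraph V E).

(** The column of a loop has a single entry 1, in accordance with [delta]. *)
Definition incidence (v : V) (e : E) : R := (v \in ends G e)%:R.

(** The equation of an edge with distinct ends [u] and [v] is [y u + y v = 0]; that of a loop is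
    [y u = 0], equivalent to [y u = - y u]. *)
Lemma incidence_transpose_kerP (y : {ffun V -> R^o}) :
  reflect (forall u v, adj G u v -> y v = - y u)
          (y \in lker (matlin (fun e v => incidence v e))).
Proof.
have sumE e : \sum_v incidence v e * y v = \sum_(v in ends G e) (y v : R).
  rewrite [RHS]big_mkcond /=; apply: eq_bigr => v _; rewrite /incidence.
  by case: ifP; rewrite (mul1r, mul0r).
have sum2 (u v : V) : y v = - y u ->
    \sum_(w in [set u; v]%SET) (y w : R) = 0.
  have [->|neuv] := eqVneq u v; first rewrite finset.setUid big_set1.
    by move/eqP; rewrite eq_sym eqNr => /eqP.
  by move=> yvN; rewrite big_setU1 ?inE //= big_set1 yvN subrr.
apply: (iffP (matlin_kerP _ _)) => [y0 u v /existsP[e /eqP uv]|yN e].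
  move: (y0 e); rewrite sumE uv.
  have [->|neuv] := eqVneq u v; last first.
    rewrite big_setU1 ?inE //= big_set1 addrC.
    by move=> /eqP; rewrite addr_eq0 => /eqP.
  by rewrite finset.setUid big_set1 => ->; rewrite oppr0.
have [u [v uv]] := ends_set2 G e.
by rewrite sumE uv; apply/sum2/yN/existsP; exists e; apply/eqP.
Qed.

Lemma incidence_transpose_ker_connect (y : {ffun V -> R^o}) u v :
  y \in lker (matlin (fun e v => incidence v e)) ->
  connect (adj G) u v -> `|y v : R| = `|y u : R|.
Proof.
move=> /incidence_transpose_kerP yN /connectP[p + ->].
elim: p u => [|w p IHp] u //= /andP[uw /IHp ->].
by rewrite (yN _ _ uw) normrN.
Qed.

(** Each edge changes the sign, so one turn around the cycle from [v] gives [y v = - y v]. *)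
Lemma incidence_transpose_ker_odd_cycle (y : {ffun V -> R^o}) c v :
  y \in lker (matlin (fun e v => incidence v e)) ->
  graph_cycle G c -> odd (size c) -> v \in unzip1 c -> y v = 0.
Proof.
move=> y_ker [c0 _ _ cyc] oddc vc.
have /mapP[x xc ->] := vc; case/splitPr: xc cyc oddc {vc c0} => a b.
(* Rotate the cycle so that it starts at the entry of [v]. *)
rewrite -[cycle _ _]/(cycle (joins G) _) -(rot_cycle (size a)) rot_size_cat.
rewrite -(size_rot (size a)) rot_size_cat /=; move: (b ++ a) => {a b}c.
have /incidence_transpose_kerP yN := y_ker.
have sign s p : path (joins G) p s ->
    y (last p s).1 = (-1) ^+ size s * (y p.1 : R) :> R.
  elim: s p => [|q s IHs] p /=; first by rewrite expr0 mul1r.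
  case/andP=> /joins_adj/yN yq /IHs ->; rewrite yq mulrN.
  by rewrite exprS mulN1r mulNr.
move=> /sign; rewrite last_rcons size_rcons -signr_odd /= => yx odd_c.
by move: yx; rewrite odd_c => /esym/eqP; rewrite expr1 mulN1r eqNr => /eqP.
Qed.

(* On a bipartite component this is the +1/-1 two-colouring with r coloured +1,
   and on a non-bipartite one it is 0: both copies of each vertex are reached. *)
Definition signing (r : V) : {ffun V -> R^o} :=
  [ffun v => (connect (double_adj G) (r, false) (v, false))%:R
           - (connect (double_adj G) (r, false) (v, true))%:R].

Lemma signing_ker r : signing r \in lker (matlin (fun e v => incidence v e)).
Proof.
apply/incidence_transpose_kerP => u v uv; rewrite !ffunE opprB.
have connE b : connect (double_adj G) (r, false) (v, b) =
           connect (double_adj G) (r, false) (u, ~~ b).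
  apply/esym/same_connect1r; first exact/sym_connect_sym/double_adj_sym.
  by rewrite /double_adj /= uv negbK /=.
by rewrite !connE.
Qed.

Lemma signing_eq0 r v : ~~ connect (adj G) r v -> signing r v = 0.
Proof.
move=> nrv; have nc b : connect (double_adj G) (r, false) (v, b) = false.
  by apply: contraNF nrv => /connect_double_adj.
by rewrite ffunE !nc subrr.
Qed.

(** Reaching the second copy of [r] would give an odd cycle in the component of [r]. *)
Lemma signing_root r :
  bipartite_on G [set v | connect (adj G) r v]%SET -> signing r r = 1.
Proof.
move=> bip; rewrite ffunE connect0; case: (boolP (connect _ _ _)); last first.
  by rewrite subr0.
case/double_connect_cycle=> c [gc oddc sub_c].
have /negP[] // : ~~ odd (size c).
by apply: bip => // v /sub_c; rewrite !inE.
Qed.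

Lemma componentsP (C : {set V}) :
  reflect (exists r, C = [set v | connect (adj G) r v]%SET) (C \in components G).
Proof.
apply: (iffP imsetP) => [[r _ ->]|[r ->]]; exists r; rewrite ?inE //;
  by apply/setP => v; rewrite !inE.
Qed.

Lemma connect_adj_sym : connect_sym (adj G).
Proof. exact/sym_connect_sym/adj_sym. Qed.

(** The absolute value of [y] is constant on components, so one zero in each suffices; a
    non-bipartite component has one on an odd cycle. *)
Lemma incidence_transpose_ker_eq0 (y : {ffun V -> R^o}) :
  y \in lker (matlin (fun e v => incidence v e)) ->
  (forall C, C \in bipartite_components G -> exists2 v, v \in C & y v = 0) ->
  y = 0.
Proof.
move=> yK y0; apply/ffunP => u; rewrite [RHS]ffunE.
set C := [set v | connect (adj G) u v]%SET.
suff [v] : exists2 v, v \in C & y v = 0.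
  rewrite inE => uv yv; apply/eqP.
  by rewrite -(normr_eq0 (y u : R)) -(incidence_transpose_ker_connect yK uv) yv normr0.
have [bipC|nbipC] := pselect (bipartite_on G C).
  apply: y0; rewrite inE; apply/andP; split; last exact/asboolP.
  by apply/componentsP; exists u.
have [c gc [sub_c /negP/negPn oddc]] : exists2 c, graph_cycle G c &
    {subset unzip1 c <= C} /\ ~ ~~ odd (size c).
  apply: contrapT => nex; apply: nbipC => c gc sub_c.
  by apply: contrapT => oddc; apply: nex; exists c.
case: c gc sub_c oddc => [[]//|p c] gc sub_c oddc.
exists p.1; first by rewrite sub_c ?mem_head.
by apply: (incidence_transpose_ker_odd_cycle yK gc oddc); rewrite mem_head.
Qed.

(** Evaluation at one chosen vertex of each bipartite component is injective on the kernel, and the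
    signings make it surjective. *)
Lemma dim_incidence_transpose_ker :
  \dim (lker (matlin (fun e v => incidence v e))) = #|bipartite_components G|.
Proof.
set K := lker _; pose I := {C : {set V} | C \in bipartite_components G}.
have /fin_all_exists[r rE] (C : I) :
    exists r, val C = [set v | connect (adj G) r v]%SET.
  by apply/componentsP; have := valP C; rewrite inE => /andP[].
pose ev := matlin (fun (C : I) v => (v == r C)%:R : R).
have evE y C : ev y C = y (r C).
  rewrite matlinE (bigD1 (r C)) //= eqxx mul1r big1 ?addr0 // => v /negPf ->.
  by rewrite mul0r.
have ev_inj : (K :&: lker ev = 0)%VS.
  apply/eqP; rewrite -subv0; apply/subvP => y.
  rewrite memv_cap memv0 memv_ker => /andP[yK /eqP evy].
  apply/eqP; apply: (incidence_transpose_ker_eq0 yK) => C CB.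
  pose D : I := exist _ C CB; exists (r D); last by rewrite -evE evy ffunE.
  have : r D \in val D by rewrite rE inE connect0.
  by [].
have ev_surj : (ev @: K = fullv)%VS.
  apply/eqP; rewrite eqEsubv subvf; apply/subvP => z _.
  (* Each signing is 1 at its own root and 0 at the other roots, which lie in other components. *)
  apply/memv_imgP; exists (\sum_C (z C : R) *: signing (r C)).
    by apply: memv_suml => C _; apply: memvZ; exact: signing_ker.
  apply/ffunP => C; rewrite evE sum_ffunE (bigD1 C) //= big1 ?addr0.
    rewrite ffunE signing_root ?[RHS]mulr1 // -rE.
    by have := valP C; rewrite inE => /andP[_ /asboolP].
  move=> D DC; rewrite ffunE signing_eq0 ?scaler0 //.
  apply: contra DC => DC; apply/eqP/val_inj; rewrite !rE.
  by apply/setP => v; rewrite !inE (same_connect connect_adj_sym DC).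
by rewrite -(limg_dim_eq ev_inj) ev_surj dim_ffun card_sig; apply: eq_card.
Qed.

End Incidence.

(** * Faces of the polytope *)

Section EdgeRestriction.
Variables (R : realType) (V E : finType) (G : multigraph V E) (A : {set E}).
Let T := {e : E | e \in A}.

Definition restrict : 'Hom({ffun E -> R^o}, {ffun T -> R^o}) :=
  matlin (fun s e => (e == val s)%:R).

Definition extend : 'Hom({ffun T -> R^o}, {ffun E -> R^o}) :=
  matlin (fun e s => (e == val s)%:R).

Lemma restrictE x s : restrict x s = x (val s).
Proof.
rewrite matlinE (bigD1 (val s)) //= eqxx mul1r big1 ?addr0 // => e /negPf ->.
by rewrite mul0r.
Qed.

Lemma extend_val w s : extend w (val s) = w s.
Proof.
rewrite matlinE (bigD1 s) //= eqxx mul1r big1 ?addr0 // => s' s's.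
by rewrite val_eqE eq_sym (negPf s's) mul0r.
Qed.

Lemma extend_notin w e : e \notin A -> extend w e = 0.
Proof.
move=> eA; rewrite matlinE big1 // => s _.
suff /negPf -> : e != val s by rewrite mul0r.
by apply: contraNneq eA => ->; exact: valP.
Qed.

Lemma extendK w : restrict (extend w) = w.
Proof. by apply/ffunP => s; rewrite restrictE extend_val. Qed.

Lemma restrictK (x : {ffun E -> R^o}) :
  (forall e, e \notin A -> x e = 0) -> extend (restrict x) = x.
Proof.
move=> x0; apply/ffunP => e; case: (boolP (e \in A)) => eA; last first.
  by rewrite extend_notin // x0.
by rewrite -[e]/(val (exist _ e eA : T)) extend_val restrictE.
Qed.

Lemma sum_delta_restrict (x : {ffun E -> R^o}) v :
    (forall e, e \notin A -> x e = 0) ->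
  \sum_(s in delta (subgraph G A) v) restrict x s = \sum_(e in delta G v) x e.
Proof.
move=> x0; rewrite [RHS](bigID (mem A)) /= [X in _ + X]big1 ?addr0; last first.
  by move=> e /andP[_ /x0].
under [RHS]eq_bigl do rewrite andbC.
rewrite big_sub_cond /=; apply: eq_big => [s|s _]; last by rewrite restrictE.
by rewrite !inE.
Qed.

Lemma bpolytope_restrict (b : {ffun V -> R}) (x : {ffun E -> R^o}) :
    (forall e, e \notin A -> x e = 0) ->
  bpolytope (subgraph G A) b (restrict x) <-> bpolytope G b x.
Proof.
move=> x0; split=> -[x_ge0 xb].
  split=> [e|v]; last by rewrite -sum_delta_restrict.
  case: (boolP (e \in A)) => eA; last by rewrite x0.
  by have := x_ge0 (exist _ e eA); rewrite restrictE.
by split=> [s|v]; rewrite ?restrictE // sum_delta_restrict.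
Qed.

(** With [A = supp F] this is the direction space of the affine hull of [F]. *)
Definition flows : {vspace {ffun E -> R^o}} :=
  (extend @: lker (matlin (@incidence R V T (subgraph G A))))%VS.

Lemma flowsP (u : {ffun E -> R^o}) :
  u \in flows <-> (forall e, e \notin A -> u e = 0) /\
                  (forall v, \sum_(e in delta G v) u e = 0).
Proof.
have sumE w v : \sum_s incidence R (subgraph G A) v s * w s =
                \sum_(s in delta (subgraph G A) v) (w s : R^o).
  rewrite [RHS]big_mkcond /=; apply: eq_bigr => s _; rewrite /incidence inE.
  by case: ifP; rewrite (mul1r, mul0r).
split=> [/memv_imgP[w /matlin_kerP w0 ->]|[u0 u_sum]].
  split=> [e|v]; first exact: extend_notin.
  rewrite -sum_delta_restrict; last exact: extend_notin.
  by rewrite extendK -sumE w0.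
rewrite -(restrictK u0); apply: memv_img; apply/matlin_kerP => v.
by rewrite sumE sum_delta_restrict.
Qed.

(** Extension by zero is injective, so only the kernel of the incidence matrix counts;
    [dim_lker_transpose] reduces it to the kernel of the transpose. *)
Lemma dim_flows :
  (\dim flows)%:Z =
  #|A|%:Z - #|V|%:Z + #|bipartite_components (subgraph G A)|%:Z.
Proof.
have extend_inj : lker extend == 0%VS.
  by apply/lker0P/(can_inj (g := restrict)); exact: extendK.
rewrite limg_dim_eq; last by apply/eqP; rewrite (eqP extend_inj) capv0.
have := dim_lker_transpose (@incidence R V T (subgraph G A)).
have -> : #|A| = #|{: T}| by rewrite card_sig; apply: eq_card.
by rewrite dim_incidence_transpose_ker addrAC -PoszD => <-; rewrite PoszD addrK.
Qed.

End EdgeRestriction.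

Lemma perturb_ge0 (R : realFieldType) (E : finType) (x u : E -> R) :
    (forall e, 0 <= x e) -> (forall e, u e != 0 -> 0 < x e) ->
  exists2 t, 0 < t & forall e, 0 <= x e + t * u e.
Proof.
(* [Q] bounds every [|u e| / x e], and the summand 1 makes it positive; [t = 1 / Q] then gives
   [t |u e| <= x e]. *)
move=> x_ge0 x_gt0; pose Q := 1 + \sum_e `|u e| / x e.
have q_ge0 e : 0 <= `|u e| / x e by rewrite divr_ge0.
have Q_gt0 : 0 < Q by rewrite ltr_pwDl // sumr_ge0.
exists Q^-1 => [|e]; first by rewrite invr_gt0.
have [->|ue] := eqVneq (u e) 0; first by rewrite mulr0 addr0.
have : `|u e| / x e <= Q.
  rewrite /Q (bigD1 e) //= addrCA lerDl.
  by apply: addr_ge0 => //; apply: sumr_ge0.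
rewrite ler_pdivrMr ?x_gt0 // [leRHS]mulrC -ler_pdivrMr // mulrC.
move=> le_x; rewrite -lerBlDr sub0r (le_trans _ le_x) //.
by rewrite -mulrN ler_wpM2l ?invr_ge0 ?(ltW Q_gt0) // -normrN ler_norm.
Qed.

(** * Points, supports and affine hull of a face *)

Section Faces.
Variables (R : realType) (V E : finType) (G : multigraph V E).
Variables (b : {ffun V -> R}) (F : set {ffun E -> R^o}).
Hypothesis F_face : is_face (bpolytope G b) F.

Lemma supp_eq0 x e : F x -> e \notin supp F -> x e = 0.
Proof.
move=> Fx; rewrite inE => /asboolPn nx; apply/eqP; apply: contraPT nx => xe.
by case; exists x.
Qed.

Lemma face_bpolytope x : F x -> bpolytope G b x.
Proof. by case: F_face => c [d [_ ->]] []. Qed.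

(** The vertex equations survive any affine combination; [a] is not confined to [[0, 1]], so
    segments can also be prolonged. *)
Lemma bpolytope_affine x y (a : R) :
    bpolytope G b x -> bpolytope G b y ->
    (forall e, 0 <= ((1 - a) * x e + a * y e : R)) ->
  bpolytope G b ((1 - a) *: x + a *: y).
Proof.
move=> [_ xb] [_ yb] ge0; split=> [e|v]; first by rewrite !ffunE; exact: ge0.
transitivity ((1 - a) * b v + a * b v); last by rewrite -mulrDl subrK mul1r.
rewrite -{1}(xb v) -(yb v) !mulr_sumr -big_split /=.
by apply: eq_bigr => e _; rewrite !ffunE.
Qed.

Lemma face_convex x y (a : R) :
  F x -> F y -> 0 <= a <= 1 -> F ((1 - a) *: x + a *: y).
Proof.
case: F_face => c [d [c_le ->]] [Px cx] [Py cy] /andP[a0 a1]; split.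
  have [x0 _] := Px; have [y0 _] := Py.
  apply: bpolytope_affine => // e.
  by rewrite addr_ge0 // mulr_ge0 // subr_ge0.
rewrite /= linearD !linearZ /= cx cy.
by rewrite -[_ + _]/((1 - a) * d + a * d) -mulrDl subrK mul1r.
Qed.

(** Edge by edge, take the midpoint with a point of [F] nonzero at the new edge: it is positive
    wherever either point is. *)
Lemma face_pos_on_supp : F !=set0 ->
  exists2 x, F x & forall e, e \in supp F -> 0 < (x e : R).
Proof.
case=> x0 Fx0.
suff [x Fx x_gt0] : exists2 x, F x &
    forall e, e \in enum E -> e \in supp F -> 0 < (x e : R).
  by exists x => // e; apply: x_gt0; rewrite mem_enum.
elim: (enum E) => [|e s [x Fx x_gt0]]; first by exists x0.
have ge0 z e' : F z -> 0 <= (z e' : R) by move/face_bpolytope=> [].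
have [|nes] := boolP (e \in supp F); last first.
  exists x => // e'; rewrite inE => /orP[/eqP ->|]; last exact: x_gt0.
  by rewrite (negPf nes).
rewrite inE => /asboolP[y Fy ye].
have half_gt0 : 0 < 2^-1 :> R by rewrite invr_gt0.
exists ((1 - 2^-1) *: x + 2^-1 *: y).
  by apply: face_convex => //; rewrite ltW //= invf_le1 ?ler1n.
have -> : 1 - 2^-1 = 2^-1 :> R by rewrite [X in X - _](splitr 1) mul1r addrK.
move=> e'; rewrite inE => e's e'F; rewrite !ffunE.
have [ex|nex] := eqVneq e' e.
  rewrite ex ltr_wpDl ?mulr_ge0 ?ge0 ?mulr_gt0 ?ltW //.
  by rewrite lt_def ye ge0.
rewrite ltr_pwDl ?mulr_ge0 ?ge0 ?mulr_gt0 ?ltW //.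
by move: e's; rewrite (negPf nex) => /x_gt0; apply.
Qed.

(* If [z] is positive wherever [x] is nonzero, the segment from [x] to [z] can be
   extended beyond [z] inside the polytope, so a linear form maximal at [z] is
   constant on it. *)
Lemma face_of_supp x : F !=set0 -> bpolytope G b x ->
  (forall e, e \notin supp F -> x e = 0) -> F x.
Proof.
move=> /face_pos_on_supp[z Fz z_gt0] Px x0.
have zP := face_bpolytope Fz; have [z_ge0 _] := zP.
have [e|e|t t_gt0 zt_ge0] := @perturb_ge0 R E z (fun e => z e - x e).
- exact: z_ge0.
- apply: contraNT => ze; have eF : e \notin supp F.
    by apply: contra ze => /z_gt0.
  by rewrite (supp_eq0 Fz eF) (x0 _ eF) subrr.
(* This is [z + t (z - x)], where the form takes the value [d + t (d - c x)]; as this is at most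
   [d], [c x >= d]. *)
have Pw : bpolytope G b ((1 - - t) *: z + (- t) *: x).
  apply: bpolytope_affine => // e; rewrite opprK mulrDl mul1r mulNr -addrA.
  by rewrite -mulrBr zt_ge0.
case: F_face Fz => c [d [c_le ->]] [_ cz]; split=> //=.
have := c_le _ Pw; rewrite linearD !linearZ /= cz => cw.
apply/le_anti; rewrite c_le //=.
have : (1 - - t) * d + (- t) * (c x : R) <= d := cw.
rewrite opprK mulrDl mul1r mulNr -addrA -mulrBr gerDl.
by rewrite pmulr_rle0 // subr_le0.
Qed.

(** Forgetting the coordinates outside [supp F] is the isomorphism; it is onto by [face_of_supp],
    applied to extensions by zero. *)
Lemma face_affine_iso : F !=set0 ->
  affinely_isomorphic F (bpolytope (gr G F) b).
Proof.
move=> F0; exists (restrict R (supp F)), 0; split=> [x Fx|x y Fx Fy|w Pw] /=.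
- rewrite addr0; apply/bpolytope_restrict; last exact: face_bpolytope.
  by move=> e; exact: supp_eq0.
- rewrite !addr0 => eq_xy; have suppF z : F z ->
      extend R (supp F) (restrict R (supp F) z) = z.
    by move=> Fz; apply: restrictK => e; exact: supp_eq0.
  by move: Fx Fy => /set_mem Fx /set_mem Fy; rewrite -(suppF x Fx) eq_xy suppF.
- exists (extend R (supp F) w); last by rewrite addr0 extendK.
  apply: face_of_supp => // [|e]; last exact: extend_notin.
  apply/(bpolytope_restrict G b (A := supp F)); last by rewrite extendK.
  by move=> e; exact: extend_notin.
Qed.

Lemma face_affine_hull x : F x -> (forall e, e \in supp F -> 0 < (x e : R)) ->
  affine_hull F = [set x + u | u in [set` flows R G (supp F)]].
Proof.
move=> Fx x_gt0; apply/seteqP; split=> y.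
  move=> [n [p [a [Fp a1 ->]]]].
  (* The coefficients sum to 1, so subtracting [x] from every point subtracts [x] from the
     combination. *)
  exists (\sum_i a i *: (p i - x)).
    apply: memv_suml => i _; apply: memvZ; apply/flowsP; split=> [e eF|v].
      by rewrite !ffunE (supp_eq0 (Fp i) eF) (supp_eq0 Fx eF) subrr.
    have [_ pb] := face_bpolytope (Fp i); have [_ xb] := face_bpolytope Fx.
    under eq_bigr do rewrite !ffunE.
    by rewrite sumrB pb xb subrr.
  under eq_bigr do rewrite scalerBr.
  by rewrite sumrB -scaler_suml a1 scale1r addrC subrK.
move=> [u /flowsP[u0 u_sum] <-].
have [e|e|t t_gt0 xt_ge0] := @perturb_ge0 R E x u.
- by have [] := face_bpolytope Fx.
- by apply: contraNT => xe; rewrite u0 //; apply: contra xe => /x_gt0.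
have F_xt : F (x + t *: u).
  have [_ xb] := face_bpolytope Fx.
  apply: face_of_supp => [||e eF]; first by exists x.
    split=> [e|v]; first by rewrite !ffunE.
    under eq_bigr do rewrite !ffunE.
    rewrite big_split /= xb -[RHS]addr0; congr (_ + _).
    transitivity (t * \sum_(e in delta G v) (u e : R)).
      by rewrite mulr_sumr.
    by rewrite u_sum mulr0.
  by rewrite !ffunE (supp_eq0 Fx eF) u0 // scaler0 addr0.
(* [x + u = (1 - 1/t) x + (1/t) (x + t u)], an affine combination of two points of [F]. *)
exists 2, (fun i => if i == ord0 then x else x + t *: u),
  (fun i => if i == ord0 then 1 - t^-1 else t^-1).
rewrite !big_ord_recl !big_ord0 /= !addr0 subrK; split=> // [i|].
  by case: ifP.
rewrite scalerDr scalerA mulVf ?gt_eqF // scale1r addrA -scalerDl subrK.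
by rewrite scale1r.
Qed.

End Faces.

Theorem theorem17 (R : realType) (V E : finType) (G : multigraph V E)
    (b : {ffun V -> R}) (F : set {ffun E -> R^o})
    (V_nonempty : (0 < #|V|)%N) (b_ge0 : forall v, 0 <= b v)
    (F_face : is_face (bpolytope G b) F) (F_nonempty : F !=set0) :
  affinely_isomorphic F (bpolytope (gr G F) b) /\
  has_dimension F
    (#|supp F|%:Z - #|V|%:Z + #|bipartite_components (gr G F)|%:Z).
Proof.
split; first exact: face_affine_iso.
have [x Fx x_gt0] := face_pos_on_supp F_face F_nonempty.
exists x, (flows R G (supp F)); split; last exact: dim_flows.
exact: (face_affine_hull F_face).
Qed.
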